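(* Let $N=\{1,\dots,n\}$ be a finite set of agents, $O$ a finite set of objects with copy numbers $(q_x)_{x\in O}$ satisfying $\sum_{x\in O}q_x\ge|N|$, and let $\mathcal{D}$ be either the unrestricted domain $\mathcal{R}$ of strict preference profiles or (when $O$ contains a null object $\emptyset$ with $q_\emptyset=|N|$) the restricted domain $\underline{\mathcal{R}}$ of profiles in which every agent ranks $\emptyset$ last. Let $f$ be a deterministic assignment rule on $\mathcal{D}$ and let $\varphi$ be the random assignment rule on $\mathcal{D}$ defined by $$\varphi_\mu(R)=\frac{1}{|N|!}\sum_{\pi\in\Pi}f_{\mu\cdot\pi}\bigl(R_{\pi(1)},R_{\pi(2)},\dots,R_{\pi(|N|)}\bigr)\qquad(R\in\mathcal{D},\ \mu\in\mathcal{M}),$$ where $\Pi$ is the set of all bijections $\pi:N\to N$ and $(\mu\cdot\pi)_i=\mu_{\pi(i)}$ for all $i\in N$. If $f$ is ex-post efficient and Maskin monotonic (or, equivalently to Maskin monotonicity, strategy-proof and non-bossy), then $\varphi$ is the Random Priority rule, i.e. $\varphi(R)=RP(R)$ for all $R\in\mathcal{D}$.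
   Context: Setting. $N$ is a finite set of $n=|N|$ agents, $O$ a finite set of objects; object $x\in O$ has $q_x\geq 1$ copies, and $\sum_{x\in O}q_x\ge|N|$. Each agent $i$ has a strict preference $R_i$ over $O$ (a linear order) with asymmetric part $P_i$. $\mathcal{R}$ is the set of all profiles $R=(R_i)_{i\in N}$ of linear orders on $O$. If $O$ contains a distinguished null object $\emptyset$ with $q_\emptyset=|N|$, then $\underline{\mathcal{R}}\subseteq\mathcal{R}$ is the set of profiles in which every agent ranks $\emptyset$ last. $U(x,R_i)=\{y\in O:y\,P_i\,x\}$. An assignment is a map $\mu:N\to O$ with $|\{i:\mu_i=x\}|\le q_x$ for all $x$; $\mathcal{M}$ is the set of assignments. $\mu$ is efficient under $R$ if there is no $\mu'\in\mathcal{M}$ with $\mu'_iR_i\mu_i$ for all $i$ and $\mu'_jP_j\mu_j$ for some $j$. A random assignment rule is a map $f:\mathcal{D}\to\Delta(\mathcal{M})$ into probability distributions on $\mathcal{M}$; $f_\mu(R)$ is the probability of $\mu$ under $f(R)$. It is deterministic if for every $R\in\mathcal{D}$ there is a single $\mu$ with $f_\mu(R)=1$; one then also writes $f(R)=\mu$ and $f_i(R)=\mu_i$. For deterministic $f$ on $\mathcal{D}$ (all profiles mentioned lying in $\mathcal{D}$): - Ex-post efficient: $f(R)$ is efficient under $R$ for every $R\in\mathcal{D}$. - Maskin monotonic: if $f(R)=\mu$ and $U(\mu_i,R'_i)\subseteq U(\mu_i,R_i)$ for all $i\in N$, then $f(R')=\mu$. - Strategy-proof: $f_i(R)\,R_i\,f_i(R'_i,R_{-i})$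 for all $R$, $i$, $R'_i$. - Non-bossy: $f_i(R)=f_i(R'_i,R_{-i})$ implies $f(R)=f(R'_i,R_{-i})$ for all $R$, $i$, $R_i'$. Random Priority. For a strict linear order $\rhd$ on $N$, $f^\rhd(R)$ is the assignment in which agents, one after another in order of $\rhd$, receive their most-preferred object among those with at least one copy still available. $RP(R)=\frac{1}{n!}\sum_{\rhd}f^\rhd(R)$, the sum being over all strict linear orders on $N$ (each $f^\rhd(R)$ viewed as a point mass). *)

(* Defs.v *)
From HB Require Import structures.
From mathcomp Require Import all_boot all_order all_fingroup all_algebra.

Set Implicit Arguments.
Unset Strict Implicit.
Unset Printing Implicit Defensive.

Import Order.TTheory GRing.Theory Num.Theory.
Local Open Scope ring_scope.

Section LinearOrders.
Variable T : finType.

Definition is_linorder (r : {ffun T * T -> bool}) : bool :=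
  [&& [forall x, forall y, r (x, y) || r (y, x)],
      [forall x, forall y, r (x, y) && r (y, x) ==> (x == y)]
    & [forall x, forall y, forall z, r (x, y) && r (y, z) ==> r (x, z)]].

Record linorder : predArgType :=
  LinOrder { linorder_graph : {ffun T * T -> bool};
             linorder_axiom : is_linorder linorder_graph }.
HB.instance Definition _ := [isSub for linorder_graph].
HB.instance Definition _ := [Finite of linorder by <:].

(* [weak r x y]: x is ranked at least as high as y (x R y).
   [strict r] is the asymmetric part (x P y). *)
Definition weak (r : linorder) : rel T := fun x y => linorder_graph r (x, y).
Definition strict (r : linorder) : rel T := fun x y => weak r x y && ~~ weak r y x.

Definition upper (x : T) (r : linorder) : {set T} := [set y | strict r y x].

Lemma linorderP (r : linorder) :
  [/\ total (weak r), antisymmetric (weak r) & transitive (weak r)].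
Proof.
case: r => r /[dup] + Hr; case/and3P=> /forallP tot /forallP anti /forallP tr.
split=> [x y | x y xy | y x z xy yz]; first exact: (forallP (tot x) y).
  by apply/eqP; exact: (implyP (forallP (anti x) y) xy).
have /implyP := forallP (forallP (tr x) y) z; apply; exact/andP.
Qed.
End LinearOrders.

Section Assignments.
Variables (n : nat) (O : finType) (q : O -> nat).

Definition profile : predArgType := {ffun 'I_n -> linorder O}.

Definition feasible (mu : {ffun 'I_n -> O}) : bool :=
  [forall x, (#|[set i | mu i == x]| <= q x)%N].

Record assignment : predArgType :=
  Assignment { assigned :> {ffun 'I_n -> O}; assigned_feasible : feasible assigned }.
HB.instance Definition _ := [isSub for assigned].
HB.instance Definition _ := [Finite of assignment by <:].

Lemma feasible_perm (mu : assignment) (pi : {perm 'I_n}) :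
  feasible [ffun i => mu (pi i)].
Proof.
apply/forallP=> x; apply: leq_trans (forallP (assigned_feasible mu) x).
rewrite -(card_imset _ (@perm_inj _ pi)); apply: subset_leq_card.
by apply/subsetP=> _ /imsetP[i + ->]; rewrite !inE ffunE.
Qed.

Definition perm_assignment (mu : assignment) (pi : {perm 'I_n}) : assignment :=
  Assignment (feasible_perm mu pi).

Definition perm_profile (R : profile) (pi : {perm 'I_n}) : profile :=
  [ffun i => R (pi i)].

(* The profile (R'_i, R_{-i}). *)
Definition deviate (R : profile) (i : 'I_n) (Ri' : linorder O) : profile :=
  [ffun j => if j == i then Ri' else R j].

Definition efficient (R : profile) (mu : assignment) : Prop :=
  ~ exists mu' : assignment,
      (forall i, weak (R i) (mu' i) (mu i)) /\ (exists j, strict (R j) (mu' j) (mu j)).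

Definition unrestricted_domain : {set profile} := [set: profile].
Definition null_last_domain (null : O) : {set profile} :=
  [set R : profile | [forall i, forall x, (x != null) ==> strict (R i) x null]].

End Assignments.

(* A rule on a domain D is a function on all profiles of which only the values
   on D are ever constrained or used. *)
Section Rules.
Variables (F : realFieldType) (n : nat) (O : finType) (q : O -> nat).
Notation profile := (profile n O).
Notation assignment := (assignment n q).

Definition rule := profile -> {ffun assignment -> F}.

Definition is_random_rule (D : {set profile}) (f : rule) : Prop :=
  forall R, R \in D -> (forall mu, 0 <= f R mu) /\ \sum_mu f R mu = 1.

Definition selects (f : rule) (R : profile) (mu : assignment) : Prop := f R mu = 1.

Definition deterministic (D : {set profile}) (f : rule) : Prop :=
  forall R, R \in D -> exists mu, selects f R mu.

Definition ex_post_efficient (D : {set profile}) (f : rule) : Prop :=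
  forall R mu, R \in D -> selects f R mu -> efficient R mu.

Definition maskin_monotonic (D : {set profile}) (f : rule) : Prop :=
  forall R R' mu, R \in D -> R' \in D -> selects f R mu ->
    (forall i, upper (mu i) (R' i) \subset upper (mu i) (R i)) ->
    selects f R' mu.

Definition strategy_proof (D : {set profile}) (f : rule) : Prop :=
  forall R i Ri' mu mu', R \in D -> deviate R i Ri' \in D ->
    selects f R mu -> selects f (deviate R i Ri') mu' ->
    weak (R i) (mu i) (mu' i).

Definition non_bossy (D : {set profile}) (f : rule) : Prop :=
  forall R i Ri' mu mu', R \in D -> deviate R i Ri' \in D ->
    selects f R mu -> selects f (deviate R i Ri') mu' ->
    mu i = mu' i -> mu = mu'.

Definition symmetrization (f : rule) : rule := fun R =>
  [ffun mu => n`!%:R^-1 *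
     \sum_(pi : {perm 'I_n}) f (perm_profile R pi) (perm_assignment mu pi)].

(* Partial allocations map agents who have not been served yet to [None]. *)
Definition available (a : {ffun 'I_n -> option O}) (x : O) : bool :=
  (#|[set j | a j == Some x]| < q x)%N.

Definition best (r : linorder O) (A : pred O) : option O :=
  [pick x | A x && [forall y, A y ==> weak r x y]].

Definition serve (R : profile) (a : {ffun 'I_n -> option O}) (i : 'I_n) :
    {ffun 'I_n -> option O} :=
  [ffun j => if j == i then best (R i) (available a) else a j].

(* A strict linear order on agents is represented by its reflexive closure;
   agents are served in the order of the list, highest priority first. *)
Definition serial_dictatorship (prio : linorder 'I_n) (R : profile) :
    {ffun 'I_n -> option O} :=
  foldl (serve R) [ffun=> None] (sort (weak prio) (enum 'I_n)).

Definition serial_dictatorship_rule (prio : linorder 'I_n) : rule := fun R =>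
  [ffun mu : assignment =>
     (serial_dictatorship prio R == [ffun i => Some (mu i)])%:R].

Definition random_priority : rule := fun R =>
  [ffun mu => n`!%:R^-1 *
     \sum_(prio : linorder 'I_n) serial_dictatorship_rule prio R mu].

End Rules.

(* Main.v *)
(** The difference [D] between the symmetrized rule and Random Priority vanishes
    off efficient assignments, is invariant under relabelling agents, sums to
    zero over assignments, and is local: [D R mu] depends on [R] only through
    the upper contour sets [U_i] of [mu i].  These properties force [D = 0], by
    induction on the cost [\sum_i 2 ^ #|U_i|] (with ties broken by the objects
    received), starting from the largest costs.  Given an efficient [mu], sort the
    objects so that each [U_i] precedes [mu i], exhausted objects first, and replace
    [R_i] by: [U_i] sorted, then [mu i], then the remaining objects sorted.  By
    locality [D R mu] is unchanged, while in the new profile every assignment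
    costs at least as much as [mu], with equality only for relabellings of [mu].
    So [0 = \sum_nu D R' nu] is a positive multiple of [D R mu]. *)

Require Import Defs.
From mathcomp Require Import all_boot all_order all_fingroup all_algebra.
From mathcomp Require Import zify.

Set Implicit Arguments.
Unset Strict Implicit.
Unset Printing Implicit Defensive.

Import GRing.Theory Num.Theory.

(** * Linear orders *)

Section LinearOrderTheory.
Variable T : finType.
Implicit Types (r : linorder T) (x y z : T).

Lemma weak_refl r x : weak r x x.
Proof. by have [tot _ _] := linorderP r; have := tot x x; rewrite orbb. Qed.

Lemma strictE r x y : strict r x y = ~~ weak r y x.
Proof.
have [tot _ _] := linorderP r; rewrite /strict.
case: (boolP (weak r y x)) => [|nyx]; rewrite ?andbF //.
by have := tot x y; rewrite (negPf nyx) orbF => ->.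
Qed.

Lemma strictxx r x : strict r x x = false.
Proof. by rewrite strictE weak_refl. Qed.

Lemma strict_neq r x y : strict r x y -> x != y.
Proof. by apply: contraTneq => ->; rewrite strictxx. Qed.

Lemma weak_eqVstrict r x y : weak r x y = (x == y) || strict r x y.
Proof.
have [tot anti _] := linorderP r.
case: eqVneq => [->|neq] /=; first exact: weak_refl.
rewrite strictE; apply/idP/idP => [xy|/negPf nyx]; last by have := tot x y; rewrite nyx orbF.
by apply: contraNN neq => yx; apply/eqP/anti; rewrite xy.
Qed.

Lemma strict_total r x y : x != y -> strict r x y || strict r y x.
Proof.
move=> neq; have := weak_eqVstrict r x y; rewrite (negPf neq) /= => <-.
by rewrite strictE orbN.
Qed.

Lemma strict_trans r y x z : strict r x y -> strict r y z -> strict r x z.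
Proof.
have [_ _ tr] := linorderP r; rewrite !strictE => nyx; apply: contraNN => zx.
have [tot _ _] := linorderP r.
by have := tot y x; rewrite (negPf nyx) => xy; exact: tr zx xy.
Qed.

Lemma strict_asym r x y : strict r x y -> strict r y x = false.
Proof. by rewrite /strict => /andP[_ /negPf ->]. Qed.

Lemma linorder_ext r r' : (forall x y, weak r x y = weak r' x y) -> r = r'.
Proof. by move=> eq_rr'; apply/val_inj/ffunP => -[x y]; apply: eq_rr'. Qed.

Lemma card_upper_lt r x y : strict r x y -> #|upper x r| < #|upper y r|.
Proof.
move=> xy; apply: proper_card; apply/properP; split.
  by apply/subsetP => z; rewrite !inE => zx; exact: strict_trans xy.
by exists x; rewrite !inE ?strictxx.
Qed.

Lemma card_upper_le r x y : (#|upper x r| <= #|upper y r|) = weak r x y.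
Proof.
rewrite weak_eqVstrict; case: eqVneq => [->|/strict_total]; first by rewrite leqnn.
move=> /(_ r) /orP[xy|yx]; first by rewrite xy ltnW ?card_upper_lt.
by rewrite strict_asym // leqNgt card_upper_lt.
Qed.

Lemma card_upper_ltE r x y : (#|upper x r| < #|upper y r|) = strict r x y.
Proof. by rewrite ltnNge card_upper_le strictE. Qed.

Lemma card_upper_inj r : injective (fun x => #|upper x r|).
Proof.
have [_ anti _] := linorderP r; move=> x y /eqP.
by rewrite eqn_leq !card_upper_le => /anti.
Qed.

Section OfKey.
Variables (k : T -> nat) (k_inj : injective k).

Lemma key_is_linorder : is_linorder [ffun p : T * T => k p.1 <= k p.2].
Proof.
apply/and3P; split.
- by apply/forallP => x; apply/forallP => y; rewrite !ffunE /= leq_total.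
- apply/forallP => x; apply/forallP => y; rewrite !ffunE /= -eqn_leq.
  by apply/implyP => /eqP /k_inj ->.
- apply/forallP => x; apply/forallP => y; apply/forallP => z; rewrite !ffunE /=.
  by apply/implyP => /andP[]; exact: leq_trans.
Qed.

Definition linorder_of_key := LinOrder key_is_linorder.

Lemma weak_of_key x y : weak linorder_of_key x y = (k x <= k y).
Proof. by rewrite /weak ffunE. Qed.

Lemma strict_of_key x y : strict linorder_of_key x y = (k x < k y).
Proof. by rewrite strictE weak_of_key -ltnNge. Qed.

End OfKey.

Lemma to_top_key_inj r x :
  injective (fun y => if y == x then 0 else #|upper y r|.+1).
Proof.
by move=> y z; do 2![case: eqP => [->|_]] => // -[/card_upper_inj].
Qed.

(** Lifting an object is the deviation through which Maskin monotonicity is exploited below: the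
    upper contour set of [x] becomes empty, and every other one gains at most [x]. *)
Definition to_top r x := linorder_of_key (@to_top_key_inj r x).

Lemma upper_to_top r x : upper x (to_top r x) = set0.
Proof. by apply/setP => y; rewrite !inE strict_of_key eqxx ltn0. Qed.

Lemma strict_to_top r x y z :
  z != x -> strict (to_top r x) y z = (y == x) || strict r y z.
Proof.
move=> /negPf zx; rewrite strict_of_key zx; case: (y == x) => //=.
by rewrite ltnS card_upper_ltE.
Qed.

End LinearOrderTheory.

(** Ranking by [#|upper i r|] identifies linear orders with permutations. Hence the factorial of [n]
    is the right normalization of [random_priority], a sum over linear orders. *)
Lemma card_linorder n : #|linorder 'I_n| = n`!.
Proof.
have rank_lt (r : linorder 'I_n) i : #|upper i r| < n.
  rewrite -[X in _ < X]card_ord; apply: proper_card.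
  by apply/properP; split; [exact/subsetP | exists i; rewrite ?inE ?strictxx].
have rank_inj r : injective (fun i => Ordinal (rank_lt r i)).
  by move=> i j /(congr1 val) /card_upper_inj.
pose of_perm (s : 'S_n) := linorder_of_key (inj_comp val_inj (@perm_inj _ s)).
pose to_perm r : 'S_n := perm (rank_inj r).
have to_permK : cancel to_perm of_perm.
  by move=> r; apply: linorder_ext => i j; rewrite weak_of_key /= !permE /= card_upper_le.
have of_permK : cancel of_perm to_perm.
  move=> s; apply/permP => i; apply/val_inj; rewrite permE /=.
  rewrite -(card_imset _ (@perm_inj _ s)).
  have -> : s @: upper i (of_perm s) = widen_ord (ltnW (ltn_ord (s i))) @: setT.
    apply/setP => j; apply/imsetP/imsetP => [[h + ->]|[h _ ->]].
      rewrite inE strict_of_key /= => lt.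
      by exists (Ordinal lt) => //; apply: val_inj.
    exists (s^-1%g (widen_ord (ltnW (ltn_ord (s i))) h)); rewrite ?permKV //.
    by rewrite inE strict_of_key /= permKV /=.
  have widen_inj m p (le : m <= p) : injective (widen_ord le).
    by move=> j h /(congr1 val) /= /val_inj.
  by rewrite (card_imset _ (@widen_inj _ _ _)) cardsT card_ord.
by rewrite -[in RHS]card_Sn; apply: bij_eq_card (Bijective to_permK of_permK).
Qed.

(** * Efficient assignments *)

Section Assignments.
Variables (n : nat) (O : finType) (q : O -> nat).
Implicit Types (R : profile n O) (mu nu : assignment n q) (i j : 'I_n) (x y : O).

Lemma assignmentP mu nu : (forall i, mu i = nu i) -> mu = nu.
Proof. by move=> eq_mu; apply/val_inj/ffunP. Qed.

Lemma card_holders mu x : #|[set i | mu i == x]| <= q x.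
Proof. exact: (forallP (assigned_feasible mu) x). Qed.

(** With a copy of [x] left over, handing it to [i] would be a Pareto improvement. *)
Lemma efficient_exhausted R mu i x :
  efficient R mu -> strict (R i) x (mu i) -> #|[set j | mu j == x]| = q x.
Proof.
move=> eff xi; apply/eqP; rewrite eqn_leq card_holders /= leqNgt.
apply/negP => free; apply: eff.
pose f := [ffun j => if j == i then x else mu j].
have f_feasible : feasible q f.
  apply/forallP => y; case: (eqVneq y x) => [->|yx].
    apply: leq_trans free; rewrite -[_.+1]add1n -(cards1 i).
    apply: leq_trans (leq_card_setU _ _); apply: subset_leq_card.
    by apply/subsetP => j; rewrite !inE ffunE; case: (j == i).
  apply: leq_trans (card_holders mu y); apply: subset_leq_card.
  apply/subsetP => j; rewrite !inE ffunE; case: (j == i) => //.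
  by rewrite eq_sym (negPf yx).
exists (Assignment f_feasible); split=> [j|].
  by rewrite /= ffunE; case: eqP => [->|_]; [rewrite weak_eqVstrict xi orbT | exact: weak_refl].
by exists i; rewrite /= ffunE eqxx.
Qed.

(* Otherwise every object of [X] is held by an agent who envies another object
   of [X]; on a minimal subset closed under this envy map the map is a
   permutation, and trading along it is a Pareto improvement. *)
Lemma efficient_source R mu (X : {set O}) :
  efficient R mu -> X != set0 ->
  exists2 x, x \in X & forall i y, mu i = x -> y \in X -> ~~ strict (R i) y x.
Proof.
move=> eff X0.
pose envied x (p : 'I_n * O) := [&& mu p.1 == x, p.2 \in X & strict (R p.1) p.2 x].
case: (boolP [exists x in X, forall p, ~~ envied x p]) => [|/exists_inPn all_envy].
  move=> /exists_inP[x xX /forallP noenvy]; exists x => // i y mui yX.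
  by have := noenvy (i, y); rewrite /envied /= mui eqxx yX.
exfalso.
have /fin_all_exists[g gP] x : exists p, x \in X -> envied x p.
  (* Outside [X] the requirement is vacuous, but a pair must still be named; one comes from an
     element of the nonempty [X]. *)
  case: (boolP (x \in X)) => [/all_envy/forallPn[p /negPn] | xX]; first by exists p.
  have [z zX] := set0Pn _ X0; have /forallPn[p _] := all_envy _ zX.
  by exists p.
pose h x := (g x).2; pose k x := (g x).1.
pose stable (Y : {set O}) := [&& Y != set0, Y \subset X & h @: Y \subset Y].
have X_stable : stable X.
  rewrite /stable X0 subxx; apply/subsetP => _ /imsetP[x xX ->].
  by have /and3P[] := gP x xX.
have [Y /minsetP[/and3P[Y0 YX hY] Ymin] _] := minset_exists X_stable.
have hYY : h @: Y = Y.
  apply: Ymin => //; rewrite /stable (subset_trans hY YX) imsetS ?andbT //.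
  by have [y yY] := set0Pn _ Y0; apply/set0Pn; exists (h y); apply: imset_f.
have h_inj : {in Y &, injective h} by apply/imset_injP; rewrite hYY.
have kP x : x \in Y -> mu (k x) = x.
  by move=> /(subsetP YX)/gP/and3P[/eqP].
have hP x : x \in Y -> strict (R (k x)) (h x) x.
  by move=> /(subsetP YX)/gP/and3P[].
(* For each [x] in [Y] only the envious holder [k x] moves, on to [h x], so exactly one copy of each
   object of [Y] changes hands. *)
pose moved i := (mu i \in Y) && (k (mu i) == i).
pose f := [ffun i => if moved i then h (mu i) else mu i].
have f_feasible : feasible q f.
  apply/forallP => x; apply: leq_trans (card_holders mu x).
  case: (boolP (x \in Y)) => xY; last first.
    apply: subset_leq_card; apply/subsetP => i; rewrite !inE ffunE.
    case: ifP => // /andP[muY _] /eqP eqx; case/negP: xY.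
    by rewrite -eqx -hYY imset_f.
  have := xY; rewrite -hYY => /imsetP[y yY xE].
  rewrite (cardsD1 (k x) [set i | mu i == x]) inE kP // eqxx.
  rewrite (cardsD1 (k y)); apply: leq_add; first exact: leq_b1.
  apply: subset_leq_card; apply/subsetP => i; rewrite !inE ffunE.
  case: ifP => [/andP[muY /eqP <-]|nmoved].
    rewrite kP // xE => /andP[neq /eqP /h_inj eqy].
    by rewrite eqy // eqxx in neq.
  case/andP=> _ muix; rewrite muix andbT; apply: contraFneq nmoved => iE.
  by rewrite /moved (eqP muix) xY iE eqxx.
apply: eff; exists (Assignment f_feasible); split=> [i|].
  rewrite /= ffunE; case: ifP => [/andP[muY /eqP ki]|_]; last exact: weak_refl.
  by rewrite weak_eqVstrict; have := hP _ muY; rewrite ki => ->; rewrite orbT.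
have [y yY] := set0Pn _ Y0; exists (k y).
by rewrite /= ffunE /moved kP // yY eqxx /=; exact: hP.
Qed.

(** Envy has no cycle: [efficient_source] supplies an object of [X] whose holders envy no object of
    [X]; it goes first and the rest is sorted by induction. *)
Lemma efficient_sorted R mu :
  efficient R mu ->
  exists t : O -> nat, forall i y, strict (R i) y (mu i) -> t y < t (mu i).
Proof.
move=> eff.
suff main m : forall X : {set O}, #|X| = m -> exists t : O -> nat,
    forall i y, mu i \in X -> y \in X -> strict (R i) y (mu i) -> t y < t (mu i).
  by have [t tP] := main _ setT erefl; exists t => i y; apply: tP; rewrite inE.
elim: m => [|m IHm] X cardX.
  by exists (fun=> 0) => i y; rewrite (cards0_eq cardX) inE.
have X0 : X != set0 by rewrite -card_gt0 cardX.
have [x xX xP] := efficient_source eff X0.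
have [|t tP] := IHm (X :\ x); first by move: cardX; rewrite (cardsD1 x) xX => -[].
exists (fun y => if y == x then 0 else (t y).+1) => i y muX yX env.
case: (eqVneq (mu i) x) => [mux|mux].
  by have := xP i y mux yX; rewrite -mux env.
by case: (eqVneq y x) => // yx; rewrite ltnS; apply: tP; rewrite // !inE ?yx ?mux.
Qed.

End Assignments.

(** * Serial dictatorship *)

Section SerialDictatorship.
Variables (n : nat) (O : finType) (q : O -> nat).
Implicit Types (R : profile n O) (mu : assignment n q) (prio : linorder 'I_n).
Implicit Types (a : {ffun 'I_n -> option O}) (s : seq 'I_n).
Implicit Types (r : linorder O) (A : pred O).

Lemma bestP r A x :
  reflect (A x /\ forall y, strict r y x -> ~~ A y) (best r A == Some x).
Proof.
have [_ anti _] := linorderP r; rewrite /best; apply: (iffP eqP).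
  case: pickP => // z /andP[Az /forallP max] [<-]; split=> // y; rewrite strictE.
  by apply: contraNN; move: (max y) => /implyP.
move=> [Ax max]; have maxx y : A y -> weak r x y.
  by move=> Ay; apply: contraLR Ay => nw; apply: max; rewrite strictE.
case: pickP => [z /andP[Az /forallP zmax]|/(_ x)]; last first.
  by rewrite Ax /= => /negP[]; apply/forallP => y; apply/implyP/maxx.
by congr Some; apply: anti; rewrite maxx // andbT; move: (zmax x); rewrite Ax.
Qed.

Lemma best_exists r A : (exists x, A x) -> best r A != None.
Proof.
case=> x0 Ax0; pose x := [arg min_(x < x0 | A x) #|upper x r|].
have [Ax min] : A x /\ forall y, A y -> #|upper x r| <= #|upper y r|.
  by rewrite /x; case: arg_minnP.
suff /eqP-> : best r A == Some x by [].
apply/bestP; split=> // y yx; apply/negP => /min.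
by rewrite leqNgt card_upper_lt.
Qed.

Lemma foldl_serve_notin R s a i : i \notin s -> foldl (serve q R) a s i = a i.
Proof.
elim: s a => //= j s IHs a; rewrite inE negb_or => /andP[ij /IHs->].
by rewrite ffunE (negPf ij).
Qed.

Lemma eq_best r A B : A =1 B -> best r A = best r B.
Proof.
move=> eqAB; apply: eq_pick => x; rewrite /= eqAB; congr (_ && _).
by apply: eq_forallb => y; rewrite eqAB.
Qed.

(** Serving later agents does not change what earlier ones hold, so the choice of [i] can be read
    off the final allocation of the agents ahead of [i]. This trades the fold for a recursive
    equation. *)
Lemma serial_dictatorshipE prio R i :
  serial_dictatorship q prio R i =
  best (R i) (fun x => #|[set j | strict prio j i
                            & serial_dictatorship q prio R j == Some x]| < q x).
Proof.
have [tot _ tr] := linorderP prio.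
set sd := serial_dictatorship q prio R; pose s := sort (weak prio) (enum 'I_n).
have : i \in s by rewrite mem_sort mem_enum.
case/path.splitPr def_s: s / => [s1 s2].
have s_uniq : uniq (s1 ++ i :: s2) by rewrite -def_s sort_uniq enum_uniq.
have mem_s j : j \in s1 ++ i :: s2 by rewrite -def_s mem_sort mem_enum.
have : pairwise (weak prio) (s1 ++ i :: s2).
  by rewrite -def_s -(sorted_pairwise tr) sort_sorted.
rewrite pairwise_cat pairwise_cons => /and3P[/allrelP le_s12 _ /andP[/allP le_is2 _]].
move: s_uniq; rewrite cat_uniq => /and3P[_ /hasPn s12 /= /andP[is2 _]].
have is1 : i \notin s1 by apply: s12; rewrite mem_head.
have before j : strict prio j i = (j \in s1).
  apply/idP/idP => [ji|js1].
    have := mem_s j; rewrite mem_cat inE => /or3P[//|/eqP eji|/le_is2].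
      by rewrite eji strictxx in ji.
    by rewrite strictE in ji; rewrite (negPf ji).
  have := le_s12 _ _ js1 (mem_head i s2); rewrite weak_eqVstrict.
  by case/orP=> // /eqP eji; rewrite -eji js1 in is1.
have sdE : sd = foldl (serve q R) (foldl (serve q R) [ffun=> None] s1) (i :: s2).
  by rewrite -foldl_cat -def_s.
have sd_s1 j : foldl (serve q R) [ffun=> None] s1 j = if j \in s1 then sd j else None.
  case: ifPn => js1; last by rewrite foldl_serve_notin ?ffunE.
  by rewrite sdE [RHS]foldl_serve_notin //; apply/negP => /s12; rewrite js1.
rewrite {1}sdE /= foldl_serve_notin // ffunE eqxx; apply: eq_best => x.
rewrite /available; congr (_ < _); apply: eq_card => j.
by rewrite !inE sd_s1 before; case: (j \in s1).
Qed.

(** Feasibility of [mu] already leaves a copy of [mu i] for [i], so only the preferred objects must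
    be gone. The criterion sees [R] through the upper contour sets at [mu] alone, which makes Random
    Priority local. *)
Lemma serial_dictatorshipP prio R mu :
  reflect (forall i x, strict (R i) x (mu i) ->
             q x <= #|[set j | strict prio j i & mu j == x]|)
          (serial_dictatorship q prio R == [ffun i => Some (mu i)]).
Proof.
apply: (iffP eqP) => [sdE i x xi|envyP].
  have := serial_dictatorshipE prio R i; rewrite sdE ffunE => /esym/eqP/bestP[_ /(_ x xi)].
  rewrite -leqNgt; congr (_ <= _); apply: eq_card => j.
  by rewrite !inE ffunE.
apply/ffunP => i; rewrite ffunE.
have [m] := ubnP #|upper i prio|; elim: m i => // m IHm i /ltnSE rank_i.
have avail x : #|[set j | strict prio j i & serial_dictatorship q prio R j == Some x]| =
               #|[set j | strict prio j i & mu j == x]|.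
  apply: eq_card => j; rewrite !inE; case ji: (strict prio j i) => //=.
  by rewrite IHm //; apply: leq_trans rank_i; exact: card_upper_lt.
rewrite serial_dictatorshipE; apply/eqP/bestP; split=> [|x xi]; rewrite avail.
  apply: leq_trans (card_holders mu (mu i)); apply: proper_card; apply/properP; split.
    by apply/subsetP => j; rewrite !inE => /andP[].
  by exists i; rewrite !inE ?strictxx ?eqxx.
by rewrite -leqNgt envyP.
Qed.

(** Fewer than [n] agents are ahead of [i], so with at least [n] copies in total some object is
    still free at the turn of [i]. *)
Lemma serial_dictatorship_total prio R :
  n <= \sum_x q x ->
  exists mu, serial_dictatorship q prio R = [ffun i => Some (mu i)].
Proof.
move=> q_sum; set sd := serial_dictatorship q prio R.
pose before i x := [set j | strict prio j i & sd j == Some x].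
have sdE i : sd i = best (R i) (fun x => #|before i x| < q x).
  exact: serial_dictatorshipE.
have sd_some i : sd i != None.
  rewrite sdE; apply: best_exists; apply/existsP; apply: contraTT q_sum.
  move=> /existsPn full; rewrite -ltnNge.
  apply: (@leq_ltn_trans (\sum_x #|before i x|)).
    by apply: leq_sum => x _; rewrite leqNgt.
  rewrite -[X in _ < X]card_ord.
  apply: (@leq_ltn_trans #|upper i prio|); last first.
    by apply: proper_card; apply/properP; split; [exact/subsetP | exists i; rewrite ?inE ?strictxx].
  have card_sum (P : pred 'I_n) : #|[set j | P j]| = \sum_j P j.
    by rewrite -sum1dep_card big_mkcond /=; apply: eq_bigr => j _; case: (P j).
  under eq_bigr do rewrite card_sum.
  rewrite card_sum exchange_big; apply: leq_sum => j _ /=.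
  case: (strict prio j i); last by rewrite big1.
  case: (sd j) => [y|]; last by rewrite big1.
  rewrite (bigD1 y) //= eqxx big1 // => x /negPf neq.
  by rewrite (inj_eq Some_inj) eq_sym neq.
have /fin_all_exists[f fP] i : exists x, sd i = Some x.
  by case: (sd i) (sd_some i) => // x _; exists x.
have f_feasible : feasible q [ffun i => f i].
  apply/forallP => x; rewrite leqNgt; apply/negP => many.
  have /set0Pn[i0 i0P] : [set i | [ffun i => f i] i == x] != set0.
    by rewrite -card_gt0; apply: leq_ltn_trans many.
  have {}i0P : f i0 == x by rewrite inE ffunE in i0P.
  (* The last-served holder of an over-assigned object would have taken it with all copies gone. *)
  have [i /eqP fi max] := @arg_maxnP _ i0 (fun i => f i == x) (fun i => #|upper i prio|) i0P.
  have := sdE i; rewrite fP fi => /esym/eqP/bestP[+ _]; apply/negP; rewrite -leqNgt.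
  move: many; rewrite (cardsD1 i) inE ffunE fi eqxx add1n ltnS => many.
  apply: leq_trans many _; apply: subset_leq_card; apply/subsetP => j; rewrite !inE ffunE fP.
  case/andP=> ji /eqP fj; rewrite fj eqxx andbT.
  have : weak prio j i by rewrite -card_upper_le; apply: max; apply/eqP.
  by rewrite weak_eqVstrict (negPf ji).
exists (Assignment f_feasible); apply/ffunP => i; rewrite !ffunE fP.
by congr Some; rewrite /= ffunE.
Qed.

End SerialDictatorship.

(** * Cost-minimal assignments *)

Section CanonicalOrder.
Variables (O : finType) (k : O -> nat).
Hypothesis k_inj : injective k.
Implicit Types (U V : {set O}) (x y z : O).

(** [K] exceeds every value of [k] and so separates the block before [z] from the block after it. *)
Let K := (\max_x k x).+1.

Lemma canonical_key_inj U z :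
  injective (fun x => if x \in U then k x else if x == z then K else K.+1 + k x).
Proof.
have k_lt x : k x < K by rewrite ltnS; exact: leq_bigmax.
move=> x y; have := k_lt x; have := k_lt y.
case: (x \in U) (y \in U) => -[] //; first by move=> _ _ /k_inj.
- by case: eqP => _; lia.
- by case: eqP => _; lia.
case: (eqVneq x z) (eqVneq y z) => [->|_] [->|_] //; try lia.
by move=> _ _ /addnI/k_inj.
Qed.

(* [U] first, then [z], then everything else, both parts sorted by [k]. *)
Definition canonical_order U z := linorder_of_key (@canonical_key_inj U z).

Lemma strict_canonical_order U z x y :
  strict (canonical_order U z) y x =
  if x \in U then (y \in U) && (k y < k x)
  else if x == z then y \in U
  else [|| y \in U, y == z | k y < k x].
Proof.
have k_lt w : k w < K by rewrite ltnS; exact: leq_bigmax.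
have := k_lt x; have := k_lt y; rewrite strict_of_key.
by do 2![case: (_ \in U) => //=]; do 2?case: (_ == z) => //=; lia.
Qed.

Lemma upper_canonical_order U z : z \notin U -> upper z (canonical_order U z) = U.
Proof.
by move=> /negPf zU; apply/setP => y; rewrite inE strict_canonical_order zU eqxx.
Qed.

Variables (m : nat) (tie : O -> nat) (E : {set O}).
Hypothesis tie_le : forall x, tie x <= m.
Hypothesis E_first : forall x y, x \in E -> y \notin E -> k x < k y.
Hypothesis tie_sorted :
  forall x y, x \notin E -> y \notin E -> k x < k y -> tie y < tie x.

(* The factor [2 * m + 1] makes any difference in the exponential terms outweigh
   two differences in [tie]. *)
Definition cost U x := (2 * m).+1 * 2 ^ #|U| + tie x.

Definition preceding x := [set y in E | k y < k x].
(** Outside [E] every object has the same [preceding] set, namely [E], and [tie] is flattened there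
    to its maximum [M], so that [slot] is constant outside [E]. *)
Let M := \max_(x | x \notin E) tie x.
Let slot x := (2 * m).+1 * 2 ^ #|preceding x| + (if x \in E then tie x else M).

Let M_le : M <= m.
Proof. exact/bigmax_leqP. Qed.

Let tie_M x : x \notin E -> tie x <= M.
Proof. by move=> xE; exact: (@leq_bigmax_cond _ (fun x => x \notin E) tie x). Qed.

Let slot_le x : preceding x \subset E.
Proof. by apply/subsetP => y; rewrite inE => /andP[]. Qed.

(* [cost V x - cost U z] is at least [slot x - slot z], so that costs of whole
   assignments are compared by the slots they occupy, of which [f] below takes
   the cheapest. If [x \in U] and [U] misses an element of [preceding z], the
   inequality holds because both exponents on the left, [#|U|] and
   [#|preceding x|], are then smaller than [#|preceding z|]. *)
Lemma cost_exchange U z x (V := upper x (canonical_order U z)) :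
  U \subset preceding z ->
  cost U z + slot x <= cost V x + slot z /\
  (cost U z + slot x = cost V x + slot z ->
     x = z \/ [/\ V = preceding x, U = preceding z, z \notin E -> tie z = M
                & x \notin E -> tie x = M]).
Proof.
move=> Uz; have zU : z \notin U.
  by apply/negP => /(subsetP Uz); rewrite inE ltnn andbF.
have UE : U \subset E := subset_trans Uz (slot_le z).
case: (eqVneq x z) => [xz|xz].
  have -> : V = U by rewrite /V xz upper_canonical_order.
  by rewrite xz addnC; split=> // _; left.
have main : [/\ V = preceding x, U = preceding z & x \notin E -> tie x = M] \/
     2 ^ #|U| + 2 ^ #|preceding x| < 2 ^ #|V| + 2 ^ #|preceding z|.
  have U_le : #|U| <= #|preceding z| := subset_leq_card Uz.
  have U_lt : U != preceding z -> #|U| < #|preceding z|.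
    by move=> neq; apply: proper_card; rewrite properEneq neq.
  have VE y : y \in V = if x \in U then (y \in U) && (k y < k x)
                        else [|| y \in U, y == z | k y < k x].
    by rewrite inE strict_canonical_order (negPf xz).
  case: (boolP (x \in U)) VE => xU VE.
    have /[!inE] /andP[xE kxz] := subsetP Uz x xU.
    have base_lt : #|preceding x| < #|preceding z|.
      apply: proper_card; apply/properP; split.
        by apply/subsetP => y; rewrite !inE => /andP[-> /ltn_trans->].
      by exists x; rewrite inE ?xE ?kxz ?ltnn.
    case: (eqVneq U (preceding z)) => [Uz'|/U_lt lt_Uz].
      left; split=> //; last by rewrite xE.
      apply/setP => y; rewrite VE Uz' !inE; case: (y \in E) => //=.
      by apply: andb_idl => /ltn_trans; apply.
    right; case: #|preceding z| base_lt lt_Uz => // b; rewrite !ltnS => le1 le2.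
    have := leq_pexp2l (isT : 0 < 2) le1; have := leq_pexp2l (isT : 0 < 2) le2.
    by have := expn_gt0 2 #|V|; rewrite expnS; lia.
  have baseV : preceding x \subset V.
    by apply/subsetP => y; rewrite VE inE => /andP[_ ->]; rewrite !orbT.
  case: (eqVneq V (preceding x)) => [Vx|neqV]; last first.
    have lt_xV : #|preceding x| < #|V|.
      by apply: proper_card; rewrite properEneq eq_sym neqV.
    right; have := leq_pexp2l (isT : 0 < 2) U_le.
    by have : 2 ^ #|preceding x| < 2 ^ #|V|; [rewrite ltn_exp2l | lia].
  case: (eqVneq U (preceding z)) => [Uz'|/U_lt lt_Uz]; last first.
    by right; rewrite Vx addnC ltn_add2l ltn_exp2l.
  (* Here [V = preceding x] contains no object outside [E], so [x] is the [k]-first such object, and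
     [tie_sorted] makes its [tie] maximal. *)
  left; split=> // xE; apply/eqP; rewrite eqn_leq tie_M //=.
  apply/bigmax_leqP => y yE; case: (eqVneq y x) => [->//|yx].
  case: (ltngtP (k x) (k y)) => [lt|lt|/k_inj/eqP].
  - exact: ltnW (tie_sorted xE yE lt).
  - have : y \in V by rewrite VE lt !orbT.
    by rewrite Vx inE (negPf yE).
  by rewrite eq_sym (negPf yx).
rewrite /cost /slot.
have := tie_le x; have := tie_le z; have := M_le.
case: main => [[-> -> xM]|lt]; last by case: ifP; case: ifP; nia.
have zM : z \notin E -> tie z <= M by exact: tie_M.
case: (boolP (x \in E)) xM => [xE _|xE /(_ isT) xM];
  case: (boolP (z \in E)) zM => [zE _|zE /(_ isT) zM] _ _ _.
all: split; first lia.
all: by move=> eqc; right; split=> // _; lia.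
Qed.

(** * Comparison of whole assignments *)

Variables (n : nat) (q : O -> nat) (f g : 'I_n -> O).
Hypothesis tie_inj : injective tie.
Hypothesis g_feasible : forall x, #|[set i | g i == x]| <= q x.
Hypothesis f_full : forall x, x \in E -> #|[set i | f i == x]| = q x.

(** All slots outside [E] equal [top], and those inside lie below it by a positive [gap]. Since [f]
    uses up every copy of the objects in [E], it collects the largest possible total gap; a [g] with
    the same total must use them up as well. *)
Let slot_sum :
  \sum_i slot (f i) <= \sum_i slot (g i) /\
  (\sum_i slot (f i) = \sum_i slot (g i) ->
     forall x, x \in E -> #|[set i | g i == x]| = #|[set i | f i == x]|).
Proof.
pose top := (2 * m).+1 * 2 ^ #|E| + M.
have slot_lt x : x \in E -> slot x < top.
  move=> xE; rewrite /slot /top xE.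
  have base_lt : #|preceding x| < #|E|.
    apply: proper_card; apply/properP; split; first exact: slot_le.
    by exists x; rewrite // inE ltnn andbF.
  by have : 2 ^ #|preceding x| < 2 ^ #|E|; [rewrite ltn_exp2l | have := tie_le x; nia].
have slot_top x : x \notin E -> slot x = top.
  move=> xE; rewrite /slot (negPf xE); congr (_ * 2 ^ _ + _).
  by apply: eq_card => y; rewrite inE; case: (boolP (y \in E)) => //= yE; rewrite E_first.
pose gap x := top - slot x.
have sum_gap (h : 'I_n -> O) :
    \sum_i slot (h i) + \sum_x #|[set i | h i == x]| * gap x = n * top.
  have <- : \sum_i gap (h i) = \sum_x #|[set i | h i == x]| * gap x.
    rewrite (partition_big h predT) //=; apply: eq_bigr => x _.
    rewrite (eq_bigr (fun=> gap x)) => [|i /eqP-> //].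
    by rewrite sum_nat_const cardsE.
  rewrite -big_split -[n in RHS]card_ord -sum_nat_const; apply: eq_bigr => i _.
  by rewrite /gap /=; case: (boolP (h i \in E)) => [/slot_lt|/slot_top]; lia.
have le_gap x : #|[set i | g i == x]| * gap x <= #|[set i | f i == x]| * gap x
    ?= iff (#|[set i | g i == x]| * gap x == #|[set i | f i == x]| * gap x).
  apply: leqif_eq; case: (boolP (x \in E)) => [xE|/slot_top eq_top].
    by rewrite leq_mul2r f_full ?g_feasible ?orbT.
  by rewrite /gap eq_top subnn !muln0.
have [le_sum eq_sum] := leqif_sum (P := predT) (fun x _ => le_gap x).
rewrite /= in le_sum eq_sum; split=> [|eq_slot x xE].
  by rewrite -(leq_add2r (\sum_x #|[set i | f i == x]| * gap x)) sum_gap -(sum_gap g) leq_add2l.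
have /forall_inP/(_ x isT)/eqP : [forall (x | predT x),
    #|[set i | g i == x]| * gap x == #|[set i | f i == x]| * gap x].
  rewrite -eq_sum; apply/eqP; have := sum_gap g.
  by rewrite -eq_slot -(sum_gap f) => /addnI.
have := slot_lt x xE; rewrite /gap => lt /eqP; rewrite eqn_mul2r.
by case/orP=> /eqP //; lia.
Qed.

(** Adding up [cost_exchange] over the agents and cancelling the slots by [slot_sum] gives the
    inequality. Equality makes it tight for every agent; whoever does not keep [f i] then has
    [preceding] sets as upper sets before and after, and the pairs of upper set and object agree as
    multisets. *)
Lemma cost_minimal (U : 'I_n -> {set O})
    (V := fun i => upper (g i) (canonical_order (U i) (f i))) :
  (forall i, U i \subset preceding (f i)) ->
  \sum_i cost (U i) (f i) <= \sum_i cost (V i) (g i) /\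
  (\sum_i cost (U i) (f i) = \sum_i cost (V i) (g i) ->
     exists pi : 'S_n, forall i, g i = f (pi i) /\ V i = U (pi i)).
Proof.
move=> Ubase.
have [le_sum eq_sum] :
    \sum_i cost (U i) (f i) + \sum_i slot (g i) <=
    \sum_i cost (V i) (g i) + \sum_i slot (f i)
    ?= iff [forall i, cost (U i) (f i) + slot (g i) == cost (V i) (g i) + slot (f i)].
  rewrite -!big_split; apply: leqif_sum => i _.
  by apply: leqif_eq; have [] := cost_exchange (g i) (Ubase i).
have [le_slot eq_slot] := slot_sum.
split=> [|eq_cost].
  rewrite -(leq_add2r (\sum_i slot (g i))); apply: leq_trans le_sum _.
  by rewrite leq_add2l.
have eq_slots : \sum_i slot (f i) = \sum_i slot (g i).
  apply/eqP; rewrite eqn_leq le_slot /=.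
  by move: le_sum; rewrite -eq_cost leq_add2l.
have {eq_slot} countE := eq_slot eq_slots.
rewrite eq_cost eq_slots eqxx in eq_sum.
have exchange i : g i = f i \/ [/\ V i = preceding (g i), U i = preceding (f i),
    f i \notin E -> tie (f i) = M & g i \notin E -> tie (g i) = M].
  have [_] := cost_exchange (g i) (Ubase i); apply; apply/eqP.
  by have /forallP/(_ i) := esym eq_sum.
have stayV i : g i = f i -> V i = U i.
  move=> gf; rewrite /V gf upper_canonical_order //.
  by apply/negP => /(subsetP (Ubase i)); rewrite inE ltnn andbF.
(* An object outside [E] with [tie] different from [M] is neither given up nor received by an agent
   who changes objects. *)
have countM x : x \notin E -> tie x != M -> #|[set i | g i == x]| = #|[set i | f i == x]|.
  move=> xE /eqP xM; apply: eq_card => i; rewrite !inE; case: (exchange i) => [->//|[_ _ fM gM]].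
  by apply/eqP/eqP => eqx; case: xM; rewrite -eqx; [apply: gM | apply: fM]; rewrite eqx.
have {countE countM} countE x : #|[set i | g i == x]| = #|[set i | f i == x]|.
  case: (boolP (x \in E)) => [/countE//|xE]; case: (eqVneq (tie x) M) => [xM|/countM->//].
  have total (h : 'I_n -> O) : \sum_y #|[set i | h i == y]| = n.
    rewrite -[RHS]card_ord -sum1_card (partition_big h predT) //=.
    by apply: eq_bigr => y _; rewrite sum1dep_card.
  (* By injectivity of [tie], [x] is the only object outside [E] with tie [M]; its count is what the
     others leave of [n]. *)
  have := total g; rewrite -[in RHS](total f) (bigD1 x) //= [RHS](bigD1 x) //=.
  rewrite [X in _ + X = _](eq_bigr (fun y => #|[set i | f i == y]|)) => [/addIn//|y yx].
  case: (boolP (y \in E)) => [/countE//|yE]; apply: countM => //.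
  by rewrite -xM (inj_eq tie_inj).
have /tuple_permP[pi piP] : perm_eq [tuple (V i, g i) | i < n] [tuple (U i, f i) | i < n].
  apply/allP => -[A x] _; apply/eqP.
  have count_card (F : 'I_n -> {set O} * O) :
      count_mem (A, x) [tuple F i | i < n] = #|[set i | F i == (A, x)]|.
    by rewrite count_map val_ord_tuple cardsE cardE -size_filter; congr size; rewrite enumT.
  rewrite /= !count_card.
  (* Agents with [g i = f i] contribute equally to both sides; for the others the object determines
     the pair, so only numbers of holders matter. *)
  pose stay := [set i | g i == f i].
  rewrite -(cardsID stay) -[RHS](cardsID stay); congr (_ + _).
    apply: eq_card => i; rewrite !inE; case: (g i =P f i) => [gf|]; rewrite ?andbF ?andbT //.
    by rewrite stayV // gf.
  case: (eqVneq A (preceding x)) => [->|neqA].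
    have := countE x; rewrite -(cardsID stay) -[RHS](cardsID stay).
    have -> : [set i | g i == x] :&: stay = [set i | f i == x] :&: stay.
      by apply/setP => i; rewrite !inE; case: (g i =P f i) => [->|]; rewrite ?andbF.
    move=> /addnI eqc.
    transitivity #|[set i | g i == x] :\: stay|; last rewrite eqc.
      apply: eq_card => i; rewrite !inE; case: (g i =P f i) => //= gf.
      case: (exchange i) => // -[-> _ _ _]; rewrite xpair_eqE.
      by case: (g i =P x) => [->|]; rewrite ?eqxx ?andbF.
    apply: eq_card => i; rewrite !inE; case: (g i =P f i) => //= gf.
    case: (exchange i) => // -[_ -> _ _]; rewrite xpair_eqE.
    by case: (f i =P x) => [->|]; rewrite ?eqxx ?andbF.
  transitivity 0; last symmetry; apply: eq_card0 => i; rewrite !inE; apply/negP.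
    case/andP=> /eqP gf /eqP[VA gx]; case: (exchange i) => // -[Vb _ _ _].
    by rewrite -VA Vb gx eqxx in neqA.
  case/andP=> /eqP gf /eqP[UA fx]; case: (exchange i) => // -[_ Ub _ _].
  by rewrite -UA Ub fx eqxx in neqA.
exists pi => i; have := congr1 (fun s => nth (V i, g i) s i) piP.
by rewrite -!tnth_nth !tnth_mktuple => -[].
Qed.

End CanonicalOrder.

(** * Local anonymous functions *)

Section Uniqueness.
Variables (n : nat) (O : finType) (q : O -> nat).
Variable null : option O.
Hypothesis q_null : forall z, null = Some z -> q z = n.
Implicit Types (R : profile n O) (mu nu : assignment n q) (x y z : O).

(** [None] stands for the unrestricted domain and [Some z] for the one with null object [z], so that
    both are handled at once. *)
Definition admissible (r : linorder O) : bool :=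
  if null is Some z then [forall x, (x != z) ==> strict r x z] else true.

(* The null object gets the least value, hence comes last in the sorted order. *)
Let tie x := if Some x == null then 0 else (enum_rank x).+1.

Let tie_le x : tie x <= #|O|.
Proof. by rewrite /tie; case: ifP => // _; exact: ltn_ord. Qed.

Let tie_inj : injective tie.
Proof.
move=> x y; rewrite /tie; do 2!case: eqP => //.
  by move=> <- [].
by move=> _ _ [] /val_inj/enum_rank_inj.
Qed.

Let full mu := [set x | #|[set i | mu i == x]| == q x].

(** Supplies the hypotheses of the cost comparison, with the exhausted objects [full mu] as [E]. The
    last clause holds because an object preferred to [mu i] is exhausted and has a smaller [t]. *)
Let reference_key R mu : efficient R mu ->
  exists k : O -> nat, [/\ injective k,
    forall x y, x \in full mu -> y \notin full mu -> k x < k y,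
    forall x y, x \notin full mu -> y \notin full mu -> k x < k y -> tie y < tie x
  & forall i, upper (mu i) (R i) \subset preceding k (full mu) (mu i)].
Proof.
move=> eff; have [t t_sorted] := efficient_sorted eff.
have [B tB] : exists B, forall x, t x * #|O| + enum_rank x < B.
  exists ((\max_x t x).+1 * #|O|) => x.
  apply: (@leq_trans ((t x).+1 * #|O|)); first by rewrite mulSn addnC ltn_add2r.
  by rewrite leq_mul2r ltnS leq_bigmax orbT.
(* Exhausted objects are keyed lexicographically by [t] and [enum_rank], the latter for injectivity;
   all stay below [B], from where the remaining objects follow by decreasing [tie]. *)
exists (fun x => if x \in full mu then t x * #|O| + enum_rank x else B + (#|O| - tie x)).
split=> [x y|x y -> /negPf->|x y /negPf-> /negPf->|i].
- case: ifPn => xE; case: ifPn => yE; last 1 first.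
  + by move=> eqk; apply: tie_inj; have := tie_le x; have := tie_le y; lia.
  + move=> /(congr1 (modn^~ #|O|)); rewrite !modnMDl !modn_small ?ltn_ord //.
    by move/val_inj/enum_rank_inj.
  + by have := tB x; lia.
  + by have := tB y; lia.
- by have := tB x; lia.
- by lia.
apply/subsetP => y; rewrite inE => yi.
have yE : y \in full mu by rewrite inE (efficient_exhausted eff yi) eqxx.
rewrite inE yE /=; case: ifP => _; last exact: ltn_addr (tB y).
apply: (@leq_trans ((t y).+1 * #|O|)); first by rewrite mulSn addnC ltn_add2r.
by apply: leq_trans (leq_addr _ _); rewrite leq_mul2r (t_sorted i y yi) orbT.
Qed.

(** If [mu i] is not the null object, fewer than [n] agents hold the latter, so it is not exhausted;
    its least [tie] then puts it last in [k]. *)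
Let canonical_admissible R mu (k : O -> nat) (k_inj : injective k) i :
  (forall x y, x \in full mu -> y \notin full mu -> k x < k y) ->
  (forall x y, x \notin full mu -> y \notin full mu -> k x < k y -> tie y < tie x) ->
  admissible (R i) ->
  admissible (canonical_order k_inj (upper (mu i) (R i)) (mu i)).
Proof.
rewrite /admissible; case def_null: null => [z|] // full_first tie_sorted.
move=> /forallP Rz; apply/forallP => x; apply/implyP => xz.
have Rlast y : y != z -> strict (R i) y z by move=> yz; have /implyP := Rz y; apply.
have zU : z \notin upper (mu i) (R i).
  rewrite inE; case: (eqVneq (mu i) z) => [->|/Rlast/strict_asym->//].
  by rewrite strictxx.
rewrite strict_canonical_order (negPf zU); case: eqVneq => [<-|zi].
  by rewrite inE Rlast.
have z_free : z \notin full mu.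
  rewrite inE (q_null def_null) neq_ltn -[X in _ < X]card_ord; apply/orP; left.
  apply: proper_card; apply/properP; split; first exact/subsetP.
  by exists i; rewrite ?inE // eq_sym.
suff -> : k x < k z by rewrite !orbT.
case: (boolP (x \in full mu)) => [/full_first->//|x_free].
case: ltngtP => // [/(tie_sorted _ _ z_free x_free)|/k_inj eqxz].
  by rewrite /tie def_null eqxx.
by rewrite eqxz eqxx in xz.
Qed.

Let theta R mu := \sum_i cost #|O| tie (upper (mu i) (R i)) (mu i).

Let canonical_profile R mu : (forall i, admissible (R i)) -> efficient R mu ->
  exists R', [/\ forall i, admissible (R' i),
    forall i, upper (mu i) (R' i) = upper (mu i) (R i)
  & forall nu, theta R' mu < theta R' nu \/
      exists pi : 'S_n, nu = perm_assignment mu pi /\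
        forall i, upper (nu i) (R' i) = upper (mu (pi i)) (R' (pi i))].
Proof.
move=> admR eff; have [k [k_inj full_first tie_sorted sub]] := reference_key eff.
have muU i : mu i \notin upper (mu i) (R i) by rewrite inE strictxx.
exists [ffun i => canonical_order k_inj (upper (mu i) (R i)) (mu i)].
split=> [i|i|nu]; rewrite ?ffunE.
- exact: canonical_admissible.
- exact: upper_canonical_order.
have mu_full x : x \in full mu -> #|[set i | mu i == x]| = q x by rewrite inE => /eqP.
have [le_cost eq_cost] := cost_minimal k_inj tie_le full_first tie_sorted tie_inj
  (card_holders nu) mu_full sub.
have thetaE : theta [ffun i => canonical_order k_inj (upper (mu i) (R i)) (mu i)] mu =
    \sum_i cost #|O| tie (upper (mu i) (R i)) (mu i).
  by apply: eq_bigr => i _; rewrite ffunE upper_canonical_order.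
have thetaE' : theta [ffun i => canonical_order k_inj (upper (mu i) (R i)) (mu i)] nu =
    \sum_i cost #|O| tie (upper (nu i) (canonical_order k_inj (upper (mu i) (R i)) (mu i))) (nu i).
  by apply: eq_bigr => i _; rewrite ffunE.
rewrite thetaE thetaE'; move: le_cost; rewrite leq_eqVlt => /orP[/eqP|]; last by left.
move=> /eq_cost[pi piP]; right; exists pi; split.
  by apply: assignmentP => i; rewrite /= ffunE; have [] := piP i.
by move=> i; rewrite !ffunE upper_canonical_order //; have [] := piP i.
Qed.

Variables (F : numDomainType) (D : profile n O -> assignment n q -> F).
Local Open Scope ring_scope.
Hypothesis D_local : forall R R' mu,
  (forall i, admissible (R i)) -> (forall i, admissible (R' i)) ->
  (forall i, upper (mu i) (R i) = upper (mu i) (R' i)) -> D R mu = D R' mu.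
Hypothesis D_efficient : forall R mu,
  (forall i, admissible (R i)) -> D R mu != 0 -> efficient R mu.
Hypothesis D_anonymous : forall R mu pi, (forall i, admissible (R i)) ->
  D (perm_profile R pi) (perm_assignment mu pi) = D R mu.
Hypothesis D_sum : forall R, (forall i, admissible (R i)) -> \sum_mu D R mu = 0.

Lemma anonymous_local_eq0 R mu : (forall i, admissible (R i)) -> D R mu = 0.
Proof.
pose theta_max := (\max_(p : profile n O * assignment n q) theta p.1 p.2)%N.
have theta_le S nu : (theta S nu <= theta_max)%N.
  exact: (leq_bigmax (F := fun p : profile n O * assignment n q => theta p.1 p.2) (S, nu)).
have [m] := ubnP (theta_max - theta R mu); elim: m R mu => // m IHm R mu le_m admR.
apply/eqP; apply: contraT => D0; have eff := D_efficient admR D0.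
have [S [admS upperS nuP]] := canonical_profile admR eff.
have thetaS : theta S mu = theta R mu by apply: eq_bigr => i _; rewrite upperS.
have DS : D S mu = D R mu by apply: D_local => // i.
(* Costlier [nu] fall under the induction hypothesis; the others are relabellings of [mu] with
   matching upper sets, where anonymity and locality reproduce the value at [mu]. *)
have DP nu : D S nu != D R mu -> D S nu = 0.
  case: (nuP nu) => [lt _|[pi [-> upper_pi]] /eqP[]].
    apply: IHm => //; have := theta_le S nu; rewrite thetaS in lt; lia.
  rewrite -DS -(D_anonymous mu pi admS); apply: D_local => // i.
    by rewrite ffunE.
  by rewrite upper_pi /= !ffunE.
(* The zero sum is now [D R mu] times the number of assignments taking that value, and [mu] is one
   of them. *)
have := D_sum admS; rewrite (bigID (fun nu => D S nu == D R mu)) /=.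
rewrite [X in _ + X]big1 ?addr0 => [|nu /DP//].
rewrite (eq_bigr (fun=> D R mu)) => [|nu /eqP//]; rewrite sumr_const => /eqP.
rewrite mulrn_eq0 (negPf D0) orbF => /eqP/card0_eq/(_ mu).
have mu_in : mu \in [pred nu | D S nu == D R mu] by rewrite inE DS.
by rewrite [LHS]mu_in.
Qed.

End Uniqueness.

(** * Rules *)

Section PermutedProfiles.
Variables (n : nat) (O : finType) (q : O -> nat).
Implicit Types (R : profile n O) (mu : assignment n q) (s : {perm 'I_n}).

Lemma perm_assignment_inj s : injective (fun mu => perm_assignment mu s).
Proof.
move=> mu nu eq_s; apply: assignmentP => i.
have := congr1 (fun nu : assignment n q => nu (s^-1%g i)) eq_s.
by rewrite /= !ffunE permKV.
Qed.

Lemma efficient_perm R mu s :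
  efficient (perm_profile R s) (perm_assignment mu s) -> efficient R mu.
Proof.
move=> eff [nu [weak_nu [j strict_nu]]]; apply: eff; exists (perm_assignment nu s).
by split=> [i|]; [|exists (s^-1%g j)]; rewrite /= !ffunE ?permKV.
Qed.

(** Agent [i] inherits the rank of [s i], just as [perm_profile] gives [i] the preference of
    [s i]. *)
Definition relabel (prio : linorder 'I_n) s :=
  linorder_of_key (inj_comp (@card_upper_inj _ prio) (@perm_inj _ s)).

Lemma relabel_inj s : injective (relabel^~ s).
Proof.
move=> p1 p2 eq_p; apply: linorder_ext => i j.
have := congr1 (fun p => weak p (s^-1%g i) (s^-1%g j)) eq_p.
by rewrite !weak_of_key /= !card_upper_le !permKV.
Qed.

Lemma serial_dictatorship_perm prio R mu s :
  (serial_dictatorship q (relabel prio s) (perm_profile R s)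
     == [ffun i => Some (perm_assignment mu s i)]) =
  (serial_dictatorship q prio R == [ffun i => Some (mu i)]).
Proof.
have card_before i x :
    #|[set j | strict (relabel prio s) j i & perm_assignment mu s j == x]| =
    #|[set j | strict prio j (s i) & mu j == x]|.
  rewrite -(card_imset _ (@perm_inj _ s)); apply: eq_card => j.
  apply/imsetP/idP => [[h + ->]|]; rewrite inE => jP.
    by move: jP; rewrite inE strict_of_key /= card_upper_ltE ffunE.
  exists (s^-1%g j); rewrite ?permKV // inE strict_of_key /= card_upper_ltE.
  by rewrite ffunE permKV.
apply/serial_dictatorshipP/serial_dictatorshipP => envyP i x xi.
  have := envyP (s^-1%g i) x; rewrite card_before /= !ffunE permKV; exact.
by rewrite card_before; apply: envyP; move: xi; rewrite /= !ffunE.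
Qed.

End PermutedProfiles.

Section Rules.
Variables (F : realFieldType) (n : nat) (O : finType) (q : O -> nat).
Variables (null : option O) (D : {set profile n O}) (f : rule F n q).
Implicit Types (R : profile n O) (mu nu : assignment n q) (r : linorder O).
Local Open Scope ring_scope.

Hypothesis q_null : forall z, null = Some z -> q z = n.
Hypothesis domP : forall R, (R \in D) = [forall i, admissible null (R i)].
Hypothesis f_rule : is_random_rule D f.
Hypothesis f_det : deterministic D f.

Let admissibleP R : reflect (forall i, admissible null (R i)) (R \in D).
Proof. by rewrite domP; exact: forallP. Qed.

Let null_last r x y : admissible null r -> Some x = null -> strict r x y = false.
Proof.
rewrite /admissible => + eq_null; rewrite -eq_null => /forallP /(_ y).
case: eqVneq => [-> _|_ /strict_asym //]; exact: strictxx.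
Qed.

Let to_top_admissible r x :
  admissible null r -> Some x != null -> admissible null (to_top r x).
Proof.
rewrite /admissible; case: null => // z /forallP rz xz; apply/forallP => y.
apply/implyP => yz; rewrite strict_to_top; last by rewrite eq_sym; apply: contraNneq xz => ->.
by have /implyP -> := rz y; rewrite ?orbT.
Qed.

Let deviate_dom R i r : R \in D -> admissible null r -> deviate R i r \in D.
Proof.
move=> /admissibleP admR adm_r; apply/admissibleP => j; rewrite ffunE.
by case: ifP.
Qed.

Let perm_profile_dom R s : R \in D -> perm_profile R s \in D.
Proof. by move=> /admissibleP admR; apply/admissibleP => j; rewrite ffunE. Qed.

Let unselected R mu nu : R \in D -> selects f R mu -> nu != mu -> f R nu = 0.
Proof.
move=> RD sel neq; have [f_ge0] := f_rule RD.
rewrite (bigD1 mu) //= sel => /eqP; rewrite -subr_eq0 addrAC subrr add0r.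
by rewrite psumr_eq0 => [/allP/(_ nu (mem_index_enum _))|nu' _ //]; rewrite neq => /eqP.
Qed.

Let selects_uniq R mu nu : R \in D -> selects f R mu -> selects f R nu -> mu = nu.
Proof.
move=> RD sel_mu sel_nu; apply/eqP; apply: contraT => neq.
by have /eqP := unselected RD sel_nu neq; rewrite sel_mu oner_eq0.
Qed.

(** If reporting [r] won an object [mu' i] preferred to [mu i], raise [mu' i] to the top of [R i].
    Neither the upper contour sets at [mu] grow from [R], nor those at [mu'] from the deviation, so
    both would be selected. *)
Lemma maskin_strategy_proof : maskin_monotonic D f -> strategy_proof D f.
Proof.
move=> mono R i r mu mu' RD R'D sel sel'.
apply: contraT; rewrite -strictE => better.
have neq : mu i != mu' i by rewrite eq_sym (strict_neq better).
have admR := admissibleP _ RD.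
have not_null : Some (mu' i) != null.
  by apply: contraTneq better => /(null_last _ (admR i))->.
have R''D : deviate R i (to_top (R i) (mu' i)) \in D.
  by apply: deviate_dom => //; exact: to_top_admissible.
suff eq_mu : mu = mu' by rewrite eq_mu eqxx in neq.
apply: (selects_uniq R''D); [apply: (mono _ _ _ RD R''D sel) | apply: (mono _ _ _ R'D R''D sel')] => j.
  rewrite !ffunE; case: eqP => // ->; apply/subsetP => y; rewrite !inE strict_to_top //.
  by case/orP=> // /eqP->.
by rewrite !ffunE; case: eqP => // ->; rewrite upper_to_top sub0set.
Qed.

(** The same device, with the common object of [i] raised to the top. *)
Lemma maskin_non_bossy : maskin_monotonic D f -> non_bossy D f.
Proof.
move=> mono R i r mu mu' RD R'D sel sel' eq_i.
have admR := admissibleP _ RD.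
(* A null object cannot be raised, but being last in [R i] it has the largest possible upper contour
   set there, so monotonicity passes directly from [R] to the deviation. *)
case: (eqVneq (Some (mu i)) null) => [is_null|not_null].
  apply: (selects_uniq R'D) sel'; apply: (mono _ _ _ RD R'D sel) => j.
  rewrite ffunE; case: eqP => // ->; apply/subsetP => y; rewrite !inE => /strict_neq neq.
  have := strict_total (R i) neq.
  by rewrite (null_last _ (admR i) is_null) orbF.
have R''D : deviate R i (to_top (R i) (mu i)) \in D.
  by apply: deviate_dom => //; exact: to_top_admissible.
apply: (selects_uniq R''D); [apply: (mono _ _ _ RD R''D sel) | apply: (mono _ _ _ R'D R''D sel')] => j.
  by rewrite !ffunE; case: eqP => // ->; rewrite upper_to_top sub0set.
by rewrite !ffunE; case: eqP => // ->; rewrite -eq_i upper_to_top sub0set.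
Qed.

(** Agents switch from [R] to [R'] one at a time. Strategy-proofness in both directions, with the
    inclusion of upper contour sets, fixes the object of the switching agent; non-bossiness fixes
    the rest. *)
Lemma strategy_proof_maskin :
  strategy_proof D f -> non_bossy D f -> maskin_monotonic D f.
Proof.
move=> sp nb R R' mu RD R'D sel sub.
have admR := admissibleP _ RD; have admR' := admissibleP _ R'D.
pose mix (k : nat) : profile n O := [ffun j : 'I_n => if (j < k)%N then R' j else R j].
have mixD k : mix k \in D by apply/admissibleP => j; rewrite ffunE; case: ifP.
suff /(_ n (leqnn n)) : forall k, (k <= n)%N -> selects f (mix k) mu.
  by have -> : mix n = R' by apply/ffunP => j; rewrite ffunE ltn_ord.
elim=> [_|k IHk lt_k]; first by have -> : mix 0%N = R by apply/ffunP => j; rewrite ffunE.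
have {IHk} sel_k := IHk (ltnW lt_k); pose i := Ordinal lt_k.
have lt_neq (j : 'I_n) : j != i -> (j < k.+1)%N = (j < k)%N.
  by rewrite -(inj_eq val_inj) ltnS leq_eqVlt => /negPf->.
have mixS : mix k.+1 = deviate (mix k) i (R' i).
  by apply/ffunP => j; rewrite !ffunE; case: eqVneq => [->|/lt_neq->//]; rewrite ltnSn.
have mix_k : mix k = deviate (mix k.+1) i (R i).
  by apply/ffunP => j; rewrite !ffunE; case: eqVneq => [->|/lt_neq->//]; rewrite ltnn.
have [mu' sel_k'] := f_det (mixD k.+1).
have sp1 : weak (R i) (mu i) (mu' i).
  have := sp (mix k) i (R' i) mu mu' (mixD k); rewrite -mixS ffunE ltnn; exact.
have sp2 : weak (R' i) (mu' i) (mu i).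
  have := sp (mix k.+1) i (R i) mu' mu (mixD _); rewrite -mix_k ffunE leqnn; exact.
suff eq_i : mu i = mu' i.
  suff -> : mu = mu' by [].
  by apply: (nb (mix k) i (R' i)); rewrite -?mixS.
apply/eqP; rewrite eq_sym; move: sp2; rewrite weak_eqVstrict => /orP[//|env].
have := subsetP (sub i) (mu' i); rewrite !inE env => /(_ isT).
by rewrite strictE sp1.
Qed.

Let maskin_local : maskin_monotonic D f -> forall R R' mu, R \in D -> R' \in D ->
  (forall i, upper (mu i) (R i) = upper (mu i) (R' i)) -> f R mu = f R' mu.
Proof.
move=> mono R R' mu RD R'D eq_up.
have [nu sel] := f_det RD; have [nu' sel'] := f_det R'D.
case: (eqVneq mu nu) sel => [<- sel|neq sel].
  have -> : f R mu = 1 := sel; apply/esym; apply: (mono _ _ _ RD R'D sel) => i.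
  by rewrite eq_up.
rewrite (unselected RD sel neq); case: (eqVneq mu nu') sel' => [<- sel'|neq' sel'].
  have : selects f R mu by apply: (mono _ _ _ R'D RD sel') => i; rewrite eq_up.
  by move=> /(selects_uniq RD sel) eq_nu; rewrite eq_nu eqxx in neq.
by rewrite (unselected R'D sel' neq').
Qed.

(** * The symmetrized rule and Random Priority *)

Let fact_neq0 : n`!%:R != 0 :> F.
Proof. by rewrite pnatr_eq0 -lt0n fact_gt0. Qed.

Lemma symmetrization_sum R : R \in D -> \sum_mu symmetrization f R mu = 1.
Proof.
move=> RD; under eq_bigr do rewrite ffunE.
rewrite -big_distrr exchange_big /= (eq_bigr (fun=> 1)) => [|s _].
  by rewrite sumr_const card_Sn mulVf ?fact_neq0.
have [_ <-] := f_rule (perm_profile_dom s RD).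
by rewrite [RHS](reindex_inj (@perm_assignment_inj _ _ q s)).
Qed.

Lemma random_priority_sum R :
  (n <= \sum_x q x)%N -> \sum_mu random_priority F q R mu = 1.
Proof.
move=> q_sum; under eq_bigr do rewrite ffunE.
rewrite -big_distrr exchange_big /= (eq_bigr (fun=> 1)) => [|prio _].
  by rewrite sumr_const card_linorder mulVf ?fact_neq0.
have [mu sdE] := serial_dictatorship_total prio R q_sum.
rewrite (bigD1 mu) //= ffunE sdE eqxx big1 ?addr0 // => nu neq; rewrite ffunE sdE.
case: eqP => // /ffunP eq_nu; case/eqP: neq; apply: assignmentP => i.
by have := eq_nu i; rewrite !ffunE => -[].
Qed.

Lemma symmetrization_perm R mu s :
  symmetrization f (perm_profile R s) (perm_assignment mu s) = symmetrization f R mu.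
Proof.
rewrite !ffunE; congr (_ * _); rewrite [RHS](reindex_inj (mulIg s)).
apply: eq_bigr => t _; congr (f _ _); last apply: assignmentP => i.
  by apply/ffunP => i; rewrite !ffunE permM.
by rewrite /= !ffunE permM.
Qed.

Lemma random_priority_perm R mu s :
  random_priority F q (perm_profile R s) (perm_assignment mu s) =
  random_priority F q R mu.
Proof.
rewrite !ffunE; congr (_ * _); rewrite [LHS](reindex_inj (@relabel_inj n s)).
by apply: eq_bigr => prio _; rewrite !ffunE serial_dictatorship_perm.
Qed.

Lemma random_priority_local R R' mu :
  (forall i, upper (mu i) (R i) = upper (mu i) (R' i)) ->
  random_priority F q R mu = random_priority F q R' mu.
Proof.
move=> eq_up; rewrite !ffunE; congr (_ * _); apply: eq_bigr => prio _.
rewrite !ffunE; congr (_%:R); congr nat_of_bool.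
have strictR i x : strict (R i) x (mu i) = strict (R' i) x (mu i).
  by have := congr1 (fun U : {set O} => x \in U) (eq_up i); rewrite !inE.
by apply/serial_dictatorshipP/serial_dictatorshipP => envyP i x xi; apply: envyP;
  rewrite ?strictR // -strictR.
Qed.

(** Given a Pareto improvement [nu], take the first agent [j] in priority whose object changes.
    Agents ahead of [j] use up [nu j] under [mu] and keep it under [nu], so [j] would be one holder
    too many. *)
Lemma random_priority_efficient R mu : random_priority F q R mu != 0 -> efficient R mu.
Proof.
rewrite ffunE mulf_eq0 negb_or => /andP[_ sum_neq0].
have [prio] : exists prio, serial_dictatorship q prio R == [ffun i => Some (mu i)].
  apply/existsP; apply: contraNT sum_neq0 => /existsPn none.
  by rewrite big1 // => prio _; rewrite ffunE (negPf (none prio)).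
move=> /serial_dictatorshipP envyP [nu [weak_nu [j0 strict_nu]]].
have j0P : nu j0 != mu j0 := strict_neq strict_nu.
have [j jP first] := @arg_minnP _ j0 (fun j => nu j != mu j) (fun j => #|upper j prio|) j0P.
have better : strict (R j) (nu j) (mu j).
  by have := weak_nu j; rewrite weak_eqVstrict (negPf jP).
have := leq_trans (card_holders nu (nu j)) (envyP j (nu j) better).
apply/negP; rewrite -ltnNge; apply: proper_card; apply/properP; split; last first.
  by exists j; rewrite !inE ?strictxx.
apply/subsetP => i; rewrite !inE => /andP[ij /eqP <-].
by apply: contraLR ij => /first; rewrite strictE -card_upper_le => ->.
Qed.

Lemma symmetrization_random_priority :
  (n <= \sum_x q x)%N -> ex_post_efficient D f -> maskin_monotonic D f ->
  forall R, R \in D -> symmetrization f R = random_priority F q R.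
Proof.
move=> q_sum eff mono R RD; apply/ffunP => mu; apply/eqP; rewrite -subr_eq0; apply/eqP.
pose diff R mu := symmetrization f R mu - random_priority F q R mu.
apply: (@anonymous_local_eq0 n O q null q_null F diff); last exact/admissibleP.
- move=> {RD mu} S S' mu admS admS' eq_up; rewrite /diff (random_priority_local eq_up).
  congr (_ - _); rewrite !ffunE; congr (_ * _); apply: eq_bigr => s _.
  apply: maskin_local => // [||i]; try by apply: perm_profile_dom; exact/admissibleP.
  by rewrite /= !ffunE.
- move=> {RD mu} S mu /admissibleP SD; rewrite /diff.
  (* Where Random Priority vanishes, a nonzero difference means that [f] selects a relabelling of
     [mu] at some relabelled profile; efficiency carries back. *)
  case: (eqVneq (random_priority F q S mu) 0) => [->|/random_priority_efficient//].
  rewrite subr0 ffunE mulf_eq0 negb_or => /andP[_ sum_neq0].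
  have [s] : exists s, f (perm_profile S s) (perm_assignment mu s) != 0.
    apply/existsP; apply: contraNT sum_neq0 => /existsPn none.
    by rewrite big1 // => s _; apply/eqP/negPn/none.
  have SsD := perm_profile_dom s SD; have [nu sel] := f_det SsD.
  case: (eqVneq (perm_assignment mu s) nu) sel => [<- sel _|neq sel].
    exact/efficient_perm/(eff _ _ SsD sel).
  by rewrite (unselected SsD sel neq) eqxx.
- by move=> S nu s _; rewrite /diff symmetrization_perm random_priority_perm.
- move=> S /admissibleP SD.
  by rewrite sumrB symmetrization_sum // random_priority_sum // subrr.
Qed.

End Rules.

Theorem corollary1 (F : realFieldType) (n : nat) (O : finType) (q : O -> nat)
    (q_pos : forall x : O, (0 < q x)%N)
    (q_sum : (n <= \sum_(x : O) q x)%N)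
    (D : {set profile n O})
    (D_domain : D = unrestricted_domain n O \/
       exists2 null : O, q null = n & D = null_last_domain n null)
    (f : rule F n q)
    (f_rule : is_random_rule D f)
    (f_det : deterministic D f) :
  (maskin_monotonic D f <-> strategy_proof D f /\ non_bossy D f) /\
  (ex_post_efficient D f ->
   maskin_monotonic D f \/ (strategy_proof D f /\ non_bossy D f) ->
   forall R : profile n O, R \in D ->
     symmetrization f R = random_priority F q R).
Proof.
have [null [q_null domP]] : exists null : option O,
    (forall z, null = Some z -> q z = n) /\
    (forall R, (R \in D) = [forall i, admissible null (R i)]).
  case: D_domain => [->|[z qz ->]]; [exists None | exists (Some z)]; split=> //.
  - by move=> R; rewrite inE; apply/esym/forallP.
  - by move=> _ [<-].
  - by move=> R; rewrite inE.
have maskinP : maskin_monotonic D f <-> strategy_proof D f /\ non_bossy D f.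
  split=> [mono|[]]; last exact: strategy_proof_maskin domP f_det.
  split; [exact: maskin_strategy_proof domP f_rule mono
         | exact: maskin_non_bossy domP f_rule mono].
split=> // eff mono.
apply: symmetrization_random_priority q_null domP f_rule f_det q_sum eff _.
by case: mono => // /maskinP.
Qed.
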